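(* Let $(W,S)$ be a Coxeter system with Coxeter matrix $(m_{st})$, and let $T\subset S$ be such that for any $t\in T$ and $s\in S-T$ the exponent $m_{st}$ is even or $\infty$. Let $\overline{W_T}$ be the normal closure of $W_T$ in $W$, which is a Coxeter group with generating set $S_T=\{wtw^{-1}: t\in T,\ w\in W_{S-T}\}$. Let $\tau_1=w_1t_1w_1^{-1}$ and $\tau_2=w_2t_2w_2^{-1}$ (with $t_1,t_2\in T$, $w_1,w_2\in W_{S-T}$) be two generators in $S_T$. For $w\in W_{S-T}$ let $w^*$ denote the shortest element of the double coset $W_{t_1^\perp-T}\,w\,W_{t_2^\perp-T}$. Then $\tau_1=\tau_2$ if and only if $t_1=t_2$ and $(w_1^{-1}w_2)^*=1$. If $\tau_1\ne\tau_2$, then the entry $m_{\tau_1\tau_2}$ of the Coxeter matrix of $(\overline{W_T},S_T)$ is $$m_{\tau_1\tau_2}=\begin{cases} m_{t_1t_2} & \text{if } t_1\neq t_2 \text{ and } (w_1^{-1}w_2)^*=1,\\ \dfrac{m_{st_1}}{2} & \text{if } t_1=t_2 \text{ and } (w_1^{-1}w_2)^*=s\in S-T,\\ \infty & \text{otherwise.}\end{cases}$$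
   Context: A Coxeter system $(W,S)$ is a group $W$ with a generating set $S$ and presentation $W=\langle S\mid (st)^{m_{st}}=1 \text{ for all } s,t\in S\rangle$, where $m_{ss}=1$ and $m_{st}=m_{ts}\in\{2,3,\dots,\infty\}$ for $s\ne t$ ($m_{st}=\infty$ means no relation). The matrix $(m_{st})$ is the Coxeter matrix. For $U\subset S$, $W_U$ is the subgroup generated by $U$. For $t\in S$, $t^\perp=\{s\in S: m_{st}=2\}$. The shortest element (with respect to word length in $S$) of a double coset $W_AwW_B$, $A,B\subset S$, is unique. The convention $\infty/2=\infty$ is used. *)

(* Defs.v *)
From HB Require Import structures.
From mathcomp Require Import all_boot.
From mathcomp Require Import boolp classical_sets.

Set Implicit Arguments.
Unset Strict Implicit.
Unset Printing Implicit Defensive.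

Local Open Scope classical_set_scope.
Local Open Scope group_scope.

(* Words in a free group over X: (x, true) stands for x, (x, false) for the
   inverse of x. *)
Definition gword (X : Type) := seq (X * bool).

Definition gword_val (W : groupType) (X : Type) (f : X -> W) (u : gword X) : W :=
  \prod_(p <- u) (if p.2 then f p.1 else (f p.1)^-1).

(* Equality in the group < X | R >. *)
Inductive pres_eq (X : Type) (R : set (gword X)) : gword X -> gword X -> Prop :=
| pres_eq_refl u : pres_eq R u u
| pres_eq_sym u v : pres_eq R u v -> pres_eq R v u
| pres_eq_trans u v w : pres_eq R u v -> pres_eq R v w -> pres_eq R u w
| pres_eq_cancel u v x b :
    pres_eq R (u ++ [:: (x, b); (x, ~~ b)] ++ v) (u ++ v)
| pres_eq_rel u r v : R r -> pres_eq R (u ++ r ++ v) (u ++ v).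

(* The subgroup G of W has the presentation < X | R >, the generator x being
   interpreted as f x. *)
Definition has_presentation (W : groupType) (G : set W) (X : Type)
    (f : X -> W) (R : set (gword X)) : Prop :=
  range (gword_val f) = G /\
  forall u v, gword_val f u = gword_val f v <-> pres_eq R u v.

(* Entries of Coxeter matrices: None stands for infinity. *)
Definition exponent := option nat.

Definition even_or_infty (e : exponent) : bool :=
  if e is Some n then ~~ odd n else true.

Definition exponent_half (e : exponent) : exponent := omap half e.

(* Matrices indexed by a subset S of W are functions on W of which only the
   values on S matter. *)
Definition coxeter_matrix (W : Type) (S : set W) (m : W -> W -> exponent) : Prop :=
  (forall s, S s -> m s s = Some 1%N) /\
  (forall s t, S s -> S t -> s <> t ->
     m s t = m t s /\ (forall n, m s t = Some n -> (2 <= n)%N)).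

Definition coxeter_relators (W : choiceType) (S : set W)
    (m : W -> W -> exponent) : set (gword S) :=
  [set r | exists s t : S, exists n, m (val s) (val t) = Some n /\
     r = flatten (nseq n [:: (s, true); (t, true)])].

(* G is a subgroup of an ambient group W, so that the notion applies both to W
   itself (with G = setT) and to its subgroups. *)
Definition coxeter_system (W : groupType) (G S : set W)
    (m : W -> W -> exponent) : Prop :=
  coxeter_matrix S m /\
  has_presentation G (fun s : S => val s) (coxeter_relators m).

Definition is_subgroup (W : groupType) (H : set W) : Prop :=
  H 1 /\ forall x y, H x -> H y -> H (x / y).

Definition generated (W : groupType) (U : set W) : set W :=
  smallest (@is_subgroup W) U.

Definition is_normal_subgroup (W : groupType) (H : set W) : Prop :=
  is_subgroup H /\ forall x w, H x -> H (w * x * w^-1).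

Definition normal_closure (W : groupType) (U : set W) : set W :=
  smallest (@is_normal_subgroup W) U.

Definition perp (W : Type) (S : set W) (m : W -> W -> exponent) (t : W) : set W :=
  [set s | S s /\ m s t = Some 2%N].

(* Arbitrarily 0 outside the subgroup generated by S. *)
Definition word_length (W : groupType) (S : set W) (w : W) : nat :=
  let lengths := [set size u | u in
    [set u : gword S | gword_val (fun s : S => val s) u = w]] in
  xget 0%N [set n | lengths n /\ forall k, lengths k -> (n <= k)%N].

Definition double_coset (W : groupType) (H K : set W) (w : W) : set W :=
  [set h * w * k | h in H & k in K].

(* A shortest element of W_A w W_B; in a Coxeter system, with A and B contained
   in S, it is unique. *)
Definition shortest_dcoset (W : groupType) (S A B : set W) (w : W) : W :=
  let D := double_coset (generated A) (generated B) w in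
  xget 1 [set x | D x /\
    forall y, D y -> (word_length S x <= word_length S y)%N].

(* The set S_T. *)
Definition conj_generators (W : groupType) (S T : set W) : set W :=
  [set w * t * w^-1 | t in T & w in generated (S `\` T)].

(* Main.v *)
Require Import Defs.
From HB Require Import structures.
From mathcomp Require Import all_boot all_algebra all_field.
From mathcomp Require Import boolp classical_sets.
From mathcomp Require Import ring.

(** Let R = S - T. The even exponents between T and R make W the semidirect
    product of the normal closure N of W_T and of W_R, and S_T consists of the
    conjugates of T under W_R. The proof has three parts, each of which lets a
    group act on a set by checking the Coxeter relators on generators
    (coxeter_action).

    The order of s t is exactly m s t in every Coxeter system (coxeter_order).
    This is the geometric representation, built here on functions instead of
    vectors and over the algebraic numbers: cos (pi / m) is replaced by half the
    sum of a primitive 2m-th root of unity and its inverse, and for an infinite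
    exponent by the same expression in a number that is not a root of unity. The
    product of two reflections then has two explicit eigenvalues, and its order
    is read off from them (iter_rotP). Neither positivity nor the length function
    is involved.

    The group N with generators S_T has the Coxeter presentation whose exponents
    are the orders of the products of two generators (normal_closure_coxeter).
    In the group presented in this way, T acts by left multiplication and R by
    conjugation, and the relators of W hold; a word in S_T that is trivial in W
    thus acts trivially, which makes it trivial in the presented group.

    It remains to compare elements of S_T and to find the orders of their
    products. If w1^-1 w2 = h^-1 v k^-1 with h in W_(t1^perp - T) and k in
    W_(t2^perp - T), then a common conjugation turns the two elements into t1 and
    v t2 v^-1. If v = 1 their product is t1 t2, and if t1 = t2 and v is in R it
    is (t1 v)^2, so that the first part gives its order. In all other cases the
    order has to be shown infinite, and elements have to be shown distinct. For
    this W acts on functions of pairs (t, coset of W_(t^perp - T) in W_R), T by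
    reflections for the matrix predicted by the theorem and R by translations
    (coset_representation). The predicted matrix is well defined because a
    parabolic subgroup contains no generators but its own (generated_generator),
    and each w t w^-1 acts as the reflection in the pair of t and the coset
    of w. Distinct pairs give distinct reflections, and the product of two of
    them has the predicted order. *)

Set Implicit Arguments.
Unset Strict Implicit.
Unset Printing Implicit Defensive.

Import GRing.Theory Num.Theory.

Local Open Scope classical_set_scope.
Local Open Scope group_scope.

(** * Exponents and roots of unity *)

(** Only 0 is a multiple of the infinite exponent, so that an element of order e
    is one whose n-th power is trivial exactly when e divides n. *)
Definition exponent_dvd (e : exponent) (n : nat) : bool :=
  if e is Some k then (k %| n)%N else n == 0%N.

Definition proper_exponent (e : exponent) : bool :=
  if e is Some k then (1 < k)%N else true.

Lemma exponent_dvd_inj e e' : e <> Some 0%N -> e' <> Some 0%N ->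
  exponent_dvd e =1 exponent_dvd e' -> e = e'.
Proof.
case: e e' => [k|] [k'|] //= k0 k'0 ee.
- have := ee k; have := ee k'; rewrite /= !dvdnn => kk' /esym k'k.
  by congr Some; apply/eqP; rewrite eqn_dvd kk'.
- by move: (ee k) => /=; rewrite dvdnn => /esym/eqP kE; case: k0; rewrite kE.
- by move: (ee k') => /=; rewrite dvdnn => /eqP kE; case: k'0; rewrite kE.
Qed.

Section Roots.
Local Open Scope ring_scope.

(** Over the complex numbers z would be exp (i pi / m), the product of two
    reflections being a rotation with eigenvalues z^2 and z^-2. For an infinite
    exponent any z whose square has infinite order does as well. The condition
    on z^2 makes the two eigenvalue equations independent. *)
Definition rotation_root (e : exponent) (z : algC) : Prop :=
  [/\ z != 0, z ^+ 2 != 1 & forall n, (z ^+ (2 * n) == 1) = exponent_dvd e n].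

Lemma rotation_root_ex e : proper_exponent e -> exists z, rotation_root e z.
Proof.
case: e => [k|] /= e2.
  have k0 : (0 < 2 * k)%N by rewrite muln_gt0 /= (ltn_trans _ e2).
  have [z zP] := C_prim_root_exists k0; exists z; split.
  - apply/eqP => z0; move: (prim_expr_order zP).
    by rewrite z0 expr0n gtn_eqF // => /esym/eqP; rewrite oner_eq0.
  - rewrite -(prim_order_dvd zP) -{2}[2%N]muln1 dvdn_pmul2l //.
    by rewrite dvdn1 neq_ltn e2 orbT.
  - by move=> n; rewrite -(prim_order_dvd zP) dvdn_pmul2l.
(* In characteristic 0 the number 2 is not a root of unity. *)
exists 2%:R; split.
- by rewrite pnatr_eq0.
- by rewrite -natrX pnatr_eq1.
- by move=> n; rewrite -natrX pnatr_eq1 -(expn0 2) eqn_exp2l // muln_eq0.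
Qed.

Definition rotation_root_of (e : exponent) : algC := xget 0 (rotation_root e).

Lemma rotation_root_ofP e : proper_exponent e ->
  rotation_root e (rotation_root_of e).
Proof. by move=> /rotation_root_ex [z zP]; apply: xgetI zP. Qed.

(** For z = exp (i pi / m) this is the classical entry - 2 cos (pi / m). *)
Definition cartan_entry (e : exponent) : algC :=
  - (rotation_root_of e + (rotation_root_of e)^-1).

End Roots.

(** * Reflections on spaces of functions *)

Section Reflections.
Local Open Scope ring_scope.
Variables (F : fieldType) (X : Type) (K : X -> X -> F).
Implicit Types (x y : X) (f g : X -> F) (z : F).

(** The contragredient of the usual reflection: f is a linear form on the space
    with basis X, and the reflection in x subtracts from it a multiple of the
    form K x. Forms, unlike vectors, are arbitrary functions, so X may be
    infinite. *)
Definition reflection x f : X -> F := fun u => f u - K x u * f x.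

Definition indicator x : X -> F := fun u => (`[< u = x >])%:R.

Lemma indicator_id x : indicator x x = 1.
Proof. by rewrite /indicator; case: asboolP. Qed.

Lemma indicator_neq x u : u <> x -> indicator x u = 0.
Proof. by rewrite /indicator; case: asboolP. Qed.

Lemma reflection_fix x f : f x = 0 -> reflection x f = f.
Proof. by move=> fx; apply/funext => u; rewrite /reflection fx mulr0 subr0. Qed.

Lemma reflectionK x : K x x = 2%:R -> involutive (reflection x).
Proof. by move=> Kx f; apply/funext => u; rewrite /reflection Kx; ring. Qed.

Lemma reflection_indicator x : K x x = 2%:R ->
  reflection x (indicator x) x = -1.
Proof. by move=> Kx; rewrite /reflection indicator_id Kx; ring. Qed.

Section Dihedral.
Variables (x y : X) (z : F).
Hypotheses (Kxx : K x x = 2%:R) (Kyy : K y y = 2%:R).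
Hypotheses (Kxy : K x y = - (z + z^-1)) (Kyx : K y x = - (z + z^-1)).
Hypotheses (z0 : z != 0) (z2 : z ^+ 2 != 1).

Let rot f := reflection x (reflection y f).

(** The values at x and y of rot f depend on those of f alone; for t = z and
    t = z^-1 this combination of them is multiplied by t^2. *)
Definition eigenform (t : F) f := f x + t * f y.

Lemma eigenform_rot f : eigenform z (rot f) = z ^+ 2 * eigenform z f.
Proof.
by rewrite /eigenform /rot /reflection Kxx Kyy Kxy Kyx; field.
Qed.

Lemma eigenformV_rot f : eigenform z^-1 (rot f) = z ^- 2 * eigenform z^-1 f.
Proof.
by rewrite /eigenform /rot /reflection Kxx Kyy Kxy Kyx; field.
Qed.

Let z2B : z ^+ 2 - 1 != 0.
Proof. by rewrite subr_eq0. Qed.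

(* The determinant 4 - (z + z^-1)^2 of the Gram matrix of x and y. *)
Let D := - (z - z^-1) ^+ 2.

(** Since the Gram matrix of x and y is invertible, every form is the sum of one
    that vanishes at x and y, which both reflections fix, and of a combination of
    K x and K y. This is the first summand. *)
Definition axis_part f : X -> F := fun u =>
  f u - (2%:R * f x + (z + z^-1) * f y) / D * K x u
      - ((z + z^-1) * f x + 2%:R * f y) / D * K y u.

Lemma axis_part_rot f : axis_part (rot f) = axis_part f.
Proof.
apply/funext => u; rewrite /axis_part /rot /reflection /D Kxx Kyy Kxy Kyx.
by field; rewrite z0 oppr_eq0 expf_neq0.
Qed.

Lemma iter_eigenform n f :
  eigenform z (iter n rot f) = z ^+ (2 * n) * eigenform z f.
Proof.
elim: n => [|n IHn]; first by rewrite muln0 mul1r.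
by rewrite iterS eigenform_rot IHn mulrA mulnS exprD.
Qed.

Lemma iter_eigenformV n f :
  eigenform z^-1 (iter n rot f) = z ^- (2 * n) * eigenform z^-1 f.
Proof.
elim: n => [|n IHn]; first by rewrite muln0 expr0 invr1 mul1r.
by rewrite iterS eigenformV_rot IHn mulrA mulnS exprD [in RHS]invfM.
Qed.

Lemma eigenform_inj f g : eigenform z f = eigenform z g ->
  eigenform z^-1 f = eigenform z^-1 g -> f x = g x /\ f y = g y.
Proof.
rewrite /eigenform => e1 e2.
have yE : f y = g y.
  have : (z ^+ 2 - 1) / z * (f y - g y) = 0.
    transitivity ((f x + z * f y - (g x + z * g y))
                  - (f x + z^-1 * f y - (g x + z^-1 * g y))); first by field.
    by rewrite e1 e2; ring.
  move=> /eqP; rewrite mulf_eq0 mulf_eq0 invr_eq0 (negPf z2B) (negPf z0) /=.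
  by rewrite subr_eq0 => /eqP.
by split=> //; move: e1; rewrite yE => /addIr.
Qed.

(** A form is determined by its axis part, which is constant along the
    iteration, and by its two eigenforms, which are multiplied by powers of z^2
    and z^-2. Hence the iterate is the identity as soon as the eigenvalues are 1;
    the indicator of x shows that this is necessary. *)
Lemma iter_rotP (xy : x <> y) n :
  (forall f, iter n rot f = f) <-> z ^+ (2 * n) = 1.
Proof.
split=> [rotn|zn f].
  have := iter_eigenform n (indicator x); rewrite rotn /eigenform indicator_id.
  by rewrite (indicator_neq (nesym xy)) mulr0 addr0 mulr1.
have [fx fy] : iter n rot f x = f x /\ iter n rot f y = f y.
  by apply: eigenform_inj;
    rewrite (iter_eigenform, iter_eigenformV) zn ?invr1 mul1r.
have ax : axis_part (iter n rot f) = axis_part f.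
  by elim: (n) => //= k IHk; rewrite axis_part_rot.
apply/funext => u; move/(congr1 (@^~ u)): ax; rewrite /axis_part fx fy.
by move=> /addIr /addIr.
Qed.

End Dihedral.
End Reflections.

Lemma reflection_order (X : Type) (K : X -> X -> algC) x y e n :
  K x x = 2%:R%R -> K y y = 2%:R%R ->
  K x y = cartan_entry e -> K y x = cartan_entry e ->
  proper_exponent e -> x <> y ->
  (forall f, iter n (fun f => reflection K x (reflection K y f)) f = f) <->
  exponent_dvd e n.
Proof.
move=> Kxx Kyy Kxy Kyx /rotation_root_ofP[z0 z2 zn] xy.
rewrite (iter_rotP Kxx Kyy Kxy Kyx z0 z2 xy n) -zn.
by split=> [->|/eqP].
Qed.

Lemma one_neq_opp1 : (1 : algC)%R <> (- 1)%R.
Proof. by apply/eqP; rewrite -subr_eq0 opprK -mulr2n pnatr_eq0. Qed.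

(** * Subgroups and actions on sets *)

Section Subgroups.
Variable W : groupType.
Implicit Types (G H U : set W) (x y : W).

Lemma subgroupV H x : is_subgroup H -> H x -> H x^-1.
Proof. by move=> [H1 HB] Hx; rewrite -div1g; apply: HB. Qed.

Lemma subgroupM H x y : is_subgroup H -> H x -> H y -> H (x * y).
Proof.
by move=> HH Hx Hy; rewrite -[y]invgK; apply: HH.2 => //; apply: subgroupV.
Qed.

Lemma generated_subgroup U : is_subgroup (generated U).
Proof.
split=> [H [[H1 _] _] //|x y Ux Uy H HU]; have [[_ HB] _] := HU.
by apply: HB; [apply: Ux | apply: Uy].
Qed.

Lemma sub_generated U : U `<=` generated U.
Proof. exact: sub_gen_smallest. Qed.

Lemma generated_sub U H : is_subgroup H -> U `<=` H -> generated U `<=` H.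
Proof. exact: smallest_sub. Qed.

Lemma generatedS U H : U `<=` H -> generated U `<=` generated H.
Proof.
move=> UH; apply: generated_sub; first exact: generated_subgroup.
by move=> x /UH; apply: sub_generated.
Qed.

Lemma involution_inv x : x * x = 1 -> x^-1 = x.
Proof. by move=> xx; apply: mulg1_eq. Qed.

Lemma generated_commute U t : (forall u, U u -> commute u t) ->
  forall g, generated U g -> commute g t.
Proof.
move=> Ut; apply: generated_sub => //; split=> [|x y xt yt].
  exact/commute_sym/commute1.
apply/commute_sym/commuteM; first exact/commute_sym.
exact/commuteV/commute_sym.
Qed.

Section Action.
Variables (V : Type) (D : set V).
Implicit Types (rho pi : W -> V -> V) (v : V).

(** The group laws are required on the subset D of V alone: D plays the part of
    a quotient or of a subobject of V, such as the classes among all the sets of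
    words. *)
Definition is_action G rho : Prop :=
  [/\ forall g v, G g -> D v -> D (rho g v),
      forall v, D v -> rho 1 v = v &
      forall g h v, G g -> G h -> D v -> rho (g * h) v = rho g (rho h v)].

Lemma actionKV G rho g v : is_subgroup G -> is_action G rho ->
  G g -> D v -> rho g^-1 (rho g v) = v.
Proof.
move=> GG [_ r1 rM] Gg Dv; rewrite -rM //; last exact: subgroupV.
by rewrite mulVg r1.
Qed.

Lemma action_agree G U rho pi : is_subgroup G -> U `<=` G ->
  is_action G rho -> is_action (generated U) pi ->
  (forall u v, U u -> D v -> rho u v = pi u v) ->
  forall g v, generated U g -> D v -> rho g v = pi g v.
Proof.
move=> GG UG rA pA rp.
have gUG : generated U `<=` G by apply: generated_sub.
have gUS := generated_subgroup U.
have [rD r1 rM] := rA; have [pD p1 pM] := pA.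
suff: generated U `<=`
    [set g | generated U g /\ forall v, D v -> rho g v = pi g v].
  by move=> sub g v /sub[_]; apply.
apply: generated_sub; last first.
  by move=> u Uu; split=> [|v Dv]; [apply: sub_generated | apply: rp].
split=> [|x y [Ux xE] [Uy yE]].
  by split=> [|v Dv]; [exact: gUS.1 | rewrite r1 // p1].
have Uy' := subgroupV gUS Uy.
split=> [|v Dv]; first exact: gUS.2.
have Dpv : D (pi y^-1 v) by apply: pD.
rewrite rM ?pM //; try exact: gUG.
rewrite -xE //; congr (rho x _).
have {1}-> : v = rho y (pi y^-1 v) by rewrite yE // -pM // mulgV p1.
by rewrite (actionKV GG rA) //; apply: gUG.
Qed.

Lemma action_iter G rho g n v : is_subgroup G -> is_action G rho ->
  G g -> D v -> rho (g ^+ n) v = iter n (rho g) v.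
Proof.
move=> GG [rD r1 rM] Gg Dv; elim: n => [|n IHn]; first exact: r1.
rewrite expgS rM // ?IHn //; elim: (n) => [|k IHk]; first exact: GG.1.
by rewrite expgS; apply: subgroupM.
Qed.

End Action.
End Subgroups.

(** * Coxeter systems acting on sets *)

Section CoxeterActions.
Variables (W : groupType) (G S : set W) (m : W -> W -> exponent).
Hypothesis hG : coxeter_system G S m.

Notation val_word := (gword_val (fun s : S => val s)).

Lemma gword_val_nil (X : Type) (f : X -> W) : gword_val f [::] = 1.
Proof. exact: big_nil. Qed.

Lemma gword_val_cons (X : Type) (f : X -> W) p u :
  gword_val f (p :: u) = (if p.2 then f p.1 else (f p.1)^-1) * gword_val f u.
Proof. exact: big_cons. Qed.

Lemma gword_val_cat (X : Type) (f : X -> W) u v :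
  gword_val f (u ++ v) = gword_val f u * gword_val f v.
Proof. exact: big_cat. Qed.

Lemma range_gword_subgroup (X : Type) (f : X -> W) :
  is_subgroup (range (gword_val f)).
Proof.
split; first by exists [::]; rewrite // gword_val_nil.
move=> _ _ [u _ <-] [v _ <-].
exists (u ++ rev [seq (p.1, ~~ p.2) | p <- v]); rewrite // gword_val_cat.
congr (_ * _); elim: v => [|[x b] v IHv].
  by rewrite gword_val_nil invg1.
rewrite /= rev_cons -cats1 gword_val_cat IHv !gword_val_cons gword_val_nil.
by rewrite mulg1 invgM /=; case: b; rewrite ?invgK.
Qed.

Lemma coxeter_subgroup : is_subgroup G.
Proof. by rewrite -hG.2.1; apply: range_gword_subgroup. Qed.

Lemma coxeter_sub : S `<=` G.
Proof.
rewrite -hG.2.1 => s Ss; have sS : s \in S by rewrite inE.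
exists [:: (exist (fun x => x \in S) s sS : S, true)] => //.
by rewrite gword_val_cons gword_val_nil mulg1.
Qed.

Lemma coxeter_diag s : S s -> m s s = Some 1%N.
Proof. exact: hG.1.1. Qed.

Lemma coxeter_val_relator (s t : S) n :
  val_word (flatten (nseq n [:: (s, true); (t, true)])) = (val s * val t) ^+ n.
Proof.
elim: n => [|n IHn]; first exact: gword_val_nil.
by rewrite /= !gword_val_cons IHn expgS /= mulgA.
Qed.

Lemma coxeter_relation s t n : S s -> S t -> m s t = Some n ->
  (s * t) ^+ n = 1.
Proof.
move=> Ss St mst; rewrite -(coxeter_val_relator (SigSub (mem_set Ss))
  (SigSub (mem_set St))) -(@gword_val_nil S (fun s => val s)).
apply/hG.2.2; rewrite -[flatten _]cats0; apply: (@pres_eq_rel _ _ [::] _ [::]).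
by exists (SigSub (mem_set Ss)), (SigSub (mem_set St)), n.
Qed.

Lemma coxeter_involution s : S s -> s * s = 1.
Proof.
by move=> Ss; rewrite -[s * s]expg1 (coxeter_relation Ss Ss) // coxeter_diag.
Qed.

Lemma coxeter_exponent_relation s t n : S s -> S t ->
  exponent_dvd (m s t) n -> (s * t) ^+ n = 1.
Proof.
move=> Ss St; case mst: (m s t) => [k|] /=; last by move=> /eqP->.
by move=> /dvdnP[q ->]; rewrite mulnC expgnA (coxeter_relation Ss St) // expg1n.
Qed.

Lemma coxeter_proper s t : S s -> S t -> s <> t -> proper_exponent (m s t).
Proof.
move=> Ss St st; have [_ m2] := hG.1.2 s t Ss St st.
by case: (m s t) m2 => //= k; apply.
Qed.

Lemma coxeter_sym s t : S s -> S t -> m s t = m t s.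
Proof.
move=> Ss St; have [->//|/eqP st] := eqVneq s t.
by have [] := hG.1.2 s t Ss St st.
Qed.

(** The universal property of the presentation: involutions that satisfy the
    relators extend to the whole group. An element acts through any word that
    represents it; two such words are related by pres_eq, which the action of
    words respects. The relators of the pairs (s, s) make every sigma s an
    involution, so that a letter and its inverse may act alike. *)
Lemma coxeter_action (V : Type) (D : set V) (sigma : W -> V -> V) :
  (forall s v, S s -> D v -> D (sigma s v)) ->
  (forall s t n v, S s -> S t -> m s t = Some n -> D v ->
     iter n (fun v => sigma s (sigma t v)) v = v) ->
  exists rho, is_action D G rho /\
    forall s v, S s -> D v -> rho s v = sigma s v.
Proof.
move=> sD srel.
have valS (s : S) : S (val s) by have := valP s; rewrite inE.
pose act (u : gword S) v := foldr (fun p => sigma (val p.1)) v u.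
have actD u v : D v -> D (act u v).
  by elim: u => //= p u IHu Dv; apply: sD; [apply: valS | apply: IHu].
have act_cat u u' v : act (u ++ u') v = act u (act u' v) by exact: foldr_cat.
have act_pres u u' : pres_eq (coxeter_relators m) u u' ->
    forall v, D v -> act u v = act u' v.
  elim=> {u u'} [//|u u' _ IH v Dv|u u' u'' _ IH1 _ IH2 v Dv|u u' x b v Dv|].
  - by rewrite IH.
  - by rewrite IH1 // IH2.
  - rewrite !act_cat; congr (act u _).
    exact: (srel _ _ 1%N _ (valS x) (valS x) (coxeter_diag (valS x)) (actD _ _ Dv)).
  move=> u r u' [s [t [n [mst ->]]]] v Dv; rewrite !act_cat; congr (act u _).
  rewrite -[RHS](srel _ _ _ _ (valS s) (valS t) mst (actD u' _ Dv)).
  by elim: (n) => //= k ->.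
have val_surj g : G g -> exists u, val_word u = g.
  by rewrite -hG.2.1 => -[u _ uE]; exists u.
pose word g : gword S := xget [::] [set u | val_word u = g].
have wordE g : G g -> val_word (word g) = g.
  by move=> /val_surj[u uE]; apply: (xgetI [::] (uE : [set u | _] u)).
have act_val u u' v : val_word u = val_word u' -> D v -> act u v = act u' v.
  by move=> /hG.2.2/act_pres; apply.
exists (fun g => act (word g)); split; first split.
- by move=> g v _; apply: actD.
- move=> v Dv; rewrite (@act_val _ [::]) // wordE ?gword_val_nil //.
  exact: coxeter_subgroup.1.
- move=> g h v Gg Gh Dv; rewrite -act_cat; apply: act_val => //.
  rewrite gword_val_cat !wordE //; exact: subgroupM coxeter_subgroup _ _.
- move=> s v Ss Dv; rewrite (@act_val _ [:: (SigSub (mem_set Ss), true)]) //.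
  by rewrite wordE ?gword_val_cons ?gword_val_nil ?mulg1 //; apply: coxeter_sub.
Qed.

End CoxeterActions.

(** * Orders of group elements *)

Section Orders.
Variable W : groupType.
Implicit Types g h : W.

(** The exponent 0 is excluded because it has the same multiples as the infinite
    one. *)
Definition is_order g (e : exponent) : Prop :=
  e <> Some 0%N /\ forall n, g ^+ n = 1 <-> exponent_dvd e n.

Lemma is_order_ex g : exists e, is_order g e.
Proof.
have [[n n0 gn]|ninf] := pselect (exists2 n, (0 < n)%N & g ^+ n = 1); last first.
  exists None; split=> // n; split=> [gn|/eqP-> //].
  by rewrite /= -leqn0 leqNgt; apply/negP => n0; apply: ninf; exists n.
have ex : exists n, (0 < n)%N && `[< g ^+ n = 1 >].
  by exists n; rewrite n0; apply/asboolP.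
case: (ex_minnP ex) => k /andP[k0 /asboolP gk] kmin.
exists (Some k); split=> [[k1]|j]; first by rewrite k1 in k0.
rewrite /= {1}(divn_eq j k) expgnDr mulnC expgnA gk expg1n mul1g.
split=> [gj|/eqP->//]; apply: contrapT => /negP; rewrite -lt0n => r0.
have := kmin (j %% k)%N; rewrite r0 (introT (asboolP _) gj) => /(_ isT).
by rewrite leqNgt ltn_mod k0.
Qed.

(* The default value None is never returned. *)
Definition order_exponent g : exponent := xget None (is_order g).

Lemma order_exponentP g : is_order g (order_exponent g).
Proof. exact: (@xgetPex _ None (is_order g) (is_order_ex g)). Qed.

Lemma is_order_uniq g e e' : is_order g e -> is_order g e' -> e = e'.
Proof.
move=> [e0 ge] [e'0 ge']; apply: exponent_dvd_inj => // n.
by apply/idP/idP => [/ge/ge'|/ge'/ge].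
Qed.

Lemma eq_is_order g h e : (forall n, g ^+ n = 1 <-> h ^+ n = 1) ->
  is_order h e -> is_order g e.
Proof. by move=> gh [e0 he]; split=> // n; rewrite gh. Qed.

Lemma is_order_half g e : even_or_infty e -> is_order g e ->
  is_order (g ^+ 2) (exponent_half e).
Proof.
case: e => [k|] /= ke [e0 ge]; last first.
  by split=> // n; rewrite -expgnA ge /= muln_eq0.
split=> [[k0]|n]; first by apply: e0; move: ke k0; case: k {ge} => [|[]].
by rewrite -expgnA ge /= -{1}(even_halfK ke) -muln2 (mulnC 2%N) dvdn_pmul2r.
Qed.

Lemma expg_conj_eq1 g h n : (g * h * g^-1) ^+ n = 1 <-> h ^+ n = 1.
Proof.
have -> : g * h * g^-1 = h ^ g^-1 by rewrite conjgE invgK mulgA.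
by rewrite -conjXg; split=> [/eqP|->]; rewrite ?conj1g // conjg_eq1 => /eqP.
Qed.

Lemma expg_inv_eq1 g n : g^-1 ^+ n = 1 <-> g ^+ n = 1.
Proof. by rewrite expVgn; split=> [/eqP|->]; rewrite ?invg1 // invg_eq1 => /eqP. Qed.

End Orders.

(** * The geometric representation *)

Section Geometric.
Variables (W : groupType) (G S : set W) (m : W -> W -> exponent).
Hypothesis hG : coxeter_system G S m.

(** The Gram matrix of the geometric representation, up to the factor 2. *)
Definition coxeter_form (x y : W) : algC :=
  (if x == y then 2%:R else cartan_entry (m x y))%R.

Lemma coxeter_form_diag x : coxeter_form x x = 2%:R%R.
Proof. by rewrite /coxeter_form eqxx. Qed.

Lemma coxeter_form_neq x y : x <> y -> coxeter_form x y = cartan_entry (m x y).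
Proof. by rewrite /coxeter_form; case: eqP. Qed.

Lemma reflection_coxeter_order s t n : S s -> S t -> s <> t ->
  (forall f, iter n (fun f => reflection coxeter_form s
                              (reflection coxeter_form t f)) f = f) <->
  exponent_dvd (m s t) n.
Proof.
move=> Ss St st; apply: reflection_order => //; first exact: coxeter_form_diag.
- exact: coxeter_form_diag.
- exact: coxeter_form_neq.
- by rewrite (coxeter_sym hG Ss St); apply/coxeter_form_neq/nesym.
- exact: coxeter_proper hG _ _ _ _ _.
Qed.

(** The defining relators hold in the space of forms because the product of two
    reflections has exactly the prescribed order. *)
Lemma geometric_representation : exists rho : W -> (W -> algC) -> (W -> algC),
  is_action [set: W -> algC] G rho /\
  forall s f, S s -> rho s f = reflection coxeter_form s f.
Proof.
have [|s t n f Ss St mst _|rho [rA rS]] := coxeter_action hG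
    (D := [set: W -> algC]) (sigma := reflection coxeter_form) => //.
  have [ste|/eqP st] := eqVneq s t.
    move: mst; rewrite -ste (coxeter_diag hG) // => -[<-] /=.
    exact/reflectionK/coxeter_form_diag.
  by apply: (reflection_coxeter_order n Ss St st).2; rewrite mst /=.
by exists rho; split=> // s f Ss; apply: rS.
Qed.

(** The presentation bounds the order of s t from above, and the geometric
    representation bounds it from below. In particular the Coxeter matrix is
    determined by the group and its generators. *)
Lemma coxeter_order s t : S s -> S t -> is_order (s * t) (m s t).
Proof.
move=> Ss St; have [<-|/eqP st] := eqVneq s t.
  rewrite (coxeter_involution hG Ss) (coxeter_diag hG Ss).
  by split=> // n; rewrite expg1n /= dvd1n.
split=> [m0|n]; first by have := coxeter_proper hG Ss St st; rewrite m0.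
split=> [stn|]; last exact: (coxeter_exponent_relation hG).
have GG := coxeter_subgroup hG; have SG := coxeter_sub hG.
have [rho [rA rS]] := geometric_representation; have [_ r1 rM] := rA.
apply/(reflection_coxeter_order n Ss St st) => f.
transitivity (rho ((s * t) ^+ n) f); last by rewrite stn r1.
rewrite (action_iter _ GG rA) //; last by apply: subgroupM => //; apply: SG.
by apply: eq_iter => g; rewrite rM // ?rS //; apply: SG.
Qed.

(** The indicator of s is fixed by the reflection in every other generator, hence
    by the subgroup that U generates if s is not in U; but s itself does not fix
    it. *)
Lemma generated_generator U s : U `<=` S -> S s -> generated U s -> U s.
Proof.
move=> US Ss Us; apply: contrapT => nUs.
have GG := coxeter_subgroup hG; have SG := coxeter_sub hG.
have [rho [rA rS]] := geometric_representation; have [_ r1 rM] := rA.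
pose f := indicator algC s.
have fU : generated U `<=` [set g | G g /\ rho g f = f].
  apply: generated_sub; last first.
    move=> u Uu; split; first exact/SG/US.
    rewrite rS; last exact: US.
    by apply/reflection_fix/indicator_neq => us; apply: nUs; rewrite -us.
  split=> [|x y [Gx xf] [Gy yf]]; first by split; [exact: GG.1 | apply: r1].
  split; first exact: GG.2.
  rewrite rM //; last exact: subgroupV.
  by rewrite -{1}yf (actionKV GG rA).
have [_] := fU s Us; rewrite rS // /f => /(congr1 (@^~ s)).
rewrite reflection_indicator ?coxeter_form_diag // indicator_id => /esym.
exact: one_neq_opp1.
Qed.

End Geometric.

(** * Presentations *)

Section Presentations.
Variables (X : Type) (Rl : set (gword X)).

Lemma pres_eq_cat a u v b : pres_eq Rl u v ->
  pres_eq Rl (a ++ u ++ b) (a ++ v ++ b).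
Proof.
elim=> {u v} [u|u v _ IH|u v w _ IH1 _ IH2|u v x c|u r v Rr].
- exact: pres_eq_refl.
- exact: pres_eq_sym.
- exact: pres_eq_trans IH1 IH2.
- rewrite -!catA [a ++ _]catA [a ++ u ++ v ++ b]catA.
  exact: pres_eq_cancel.
- by rewrite -!catA [a ++ _]catA [a ++ u ++ v ++ b]catA; apply: pres_eq_rel.
Qed.

Lemma pres_eq_cons p u v : pres_eq Rl u v -> pres_eq Rl (p :: u) (p :: v).
Proof. by move=> /(pres_eq_cat [:: p] [::]); rewrite !cats0. Qed.

Lemma pres_eq_sound (W : groupType) (f : X -> W) u v :
  (forall r, Rl r -> gword_val f r = 1) ->
  pres_eq Rl u v -> gword_val f u = gword_val f v.
Proof.
move=> fR; elim=> {u v} [//|//|u v w _ -> _ ->//|u v x b|u r v Rr].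
  rewrite !gword_val_cat !gword_val_cons gword_val_nil /= mulg1.
  by case: b => /=; rewrite -mulgA (mulKg, mulVKg).
by rewrite !gword_val_cat (fR r) // mul1g.
Qed.

End Presentations.

(** The relator of (s, t) follows from that of (t, s). *)
Lemma iter_swap (V : Type) (f g : V -> V) n v :
  iter n (fun v => f (g v)) (f v) = f (iter n (fun v => g (f v)) v).
Proof. by elim: n => //= n ->. Qed.

(** * The normal closure as a Coxeter group *)

Section NormalClosure.
Variables (W : groupType) (S T : set W) (m : W -> W -> exponent).
Hypothesis hW : coxeter_system [set: W] S m.
Hypothesis hTS : T `<=` S.
Hypothesis hT : forall t s, T t -> (S `\` T) s -> even_or_infty (m t s).

Local Notation WR := (generated (S `\` T)).
Local Notation ST := (conj_generators S T).
Local Notation N := (normal_closure (generated T)).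

Lemma sub_conj_generators : T `<=` ST.
Proof.
move=> t Tt; exists t => //; exists 1; first exact: (generated_subgroup _).1.
by rewrite mul1g invg1 mulg1.
Qed.

Lemma conj_generator_conj g x : WR g -> ST x -> ST (g * x * g^-1).
Proof.
move=> Rg [t Tt [w Rw <-]]; exists t => //; exists (g * w).
  exact: (subgroupM (generated_subgroup _)).
by rewrite invgM !mulgA.
Qed.

Lemma conj_generator_involution x : ST x -> x * x = 1.
Proof.
move=> [t Tt [w _ <-]].
by rewrite !mulgA mulgVK -(mulgA w) (coxeter_involution hW (hTS Tt)) mulg1 mulgV.
Qed.

Lemma normal_closure_normal U : is_normal_subgroup (normal_closure U : set W).
Proof.
split; first split=> [H [[[H1 _] _] _] //|x y Ux Uy H HU].
  have [[[_ HB] _] _] := HU.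
  by apply: HB; [apply: Ux | apply: Uy].
by move=> x w Ux H HU; apply: HU.1.2; apply: Ux.
Qed.

Lemma generator_ind (P : set W) : is_subgroup P -> S `<=` P -> forall g, P g.
Proof.
move=> PP SP g; have [_ /(_ g I) [u _ <-]] : True /\ [set: W] `<=`
  range (gword_val (fun s : S => val s)) by rewrite hW.2.1.
elim: u => [|[s b] u IHu]; first by rewrite gword_val_nil; exact: PP.1.
rewrite gword_val_cons; apply: subgroupM => //=.
have /SP Ps : S (val s) by have := valP s; rewrite inE.
by case: b => //; apply: subgroupV.
Qed.

Local Notation val_word := (gword_val (fun x : ST => val x)).

Let valST (x : ST) : ST (val x).
Proof. by have := valP x; rewrite inE. Qed.

(** The subgroup generated by the conjugates of T under W_(S - T) is already
    normal: a generator in S - T permutes them, and one in T lies in that subgroup. *)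
Lemma range_conj_generators : range val_word = N.
Proof.
have [NS NC] := normal_closure_normal (generated T).
have TN : generated T `<=` N by exact: sub_gen_smallest.
apply/seteqP; split.
  move=> _ [u _ <-]; elim: u => [|[x b] u IHu].
    by rewrite gword_val_nil; exact: NS.1.
  rewrite gword_val_cons; apply: (subgroupM NS) => //=.
  have Nx : N (val x).
    have [t Tt [w _ <-]] := valST x; apply: NC.
    exact: TN (sub_generated Tt).
  by case: b => //; apply: (subgroupV NS).
have RS := range_gword_subgroup (fun x : ST => val x).
have STr x : ST x -> range val_word x.
  move=> xS; exists [:: (SigSub (mem_set xS), true)] => //.
  by rewrite gword_val_cons gword_val_nil mulg1.
apply: smallest_sub; last first.
  by apply: generated_sub => // t Tt; apply/STr/sub_conj_generators.
split=> // x w; move: w x.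
suff: forall w, [set w | forall x, range val_word x ->
    range val_word (w * x * w^-1) /\ range val_word (w^-1 * x * w)] w.
  by move=> h w x /(h w x)[].
apply: generator_ind.
  split=> [x|w1 w2 h1 h2 x rx]; first by rewrite invg1 !mul1g mulg1.
  rewrite invgF; split.
    by have [_ /h1[+ _]] := h2 x rx; rewrite !mulgA.
  by have [_ /h2[+ _]] := h1 x rx; rewrite !mulgA.
move=> s Ss; suff h x : range val_word x -> range val_word (s * x * s^-1).
  move=> x rx; have := h x rx.
  by rewrite (involution_inv (coxeter_involution hW Ss)).
have [Ts|nTs] := pselect (T s).
  have rs : range val_word s by exact/STr/sub_conj_generators.
  move=> rx; apply: (subgroupM RS); last exact: (subgroupV RS).
  exact: (subgroupM RS).
move=> [u _ <-]; elim: u => [|[y b] u IHu].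
  by rewrite gword_val_nil mulg1 mulgV; exact: RS.1.
rewrite gword_val_cons /= !mulgA.
have -> : s * (if b then val y else (val y)^-1) * gword_val (fun x : ST => val x) u / s
  = (s * (if b then val y else (val y)^-1) / s) * (s * val_word u / s).
  by rewrite !mulgA mulgVK.
apply: (subgroupM RS) => //.
have ry : range val_word (s * val y / s).
  by apply/STr/conj_generator_conj => //; apply: sub_generated.
by case: (b) => //; move/(subgroupV RS): ry; rewrite invgF invgM mulgA.
Qed.

Definition conj_exponent (x y : W) : exponent := order_exponent (x * y).

Lemma conj_exponent_matrix : coxeter_matrix ST conj_exponent.
Proof.
have P x y : is_order (x * y) (conj_exponent x y) by apply: order_exponentP.
split=> [x xS|x y xS yS xy].
  apply: is_order_uniq (P x x) _; rewrite conj_generator_involution //.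
  by split=> // n; rewrite expg1n /= dvd1n.
split=> [|n nE].
  apply: is_order_uniq (P x y) _; apply: eq_is_order (P y x) => n.
  rewrite -expg_inv_eq1 invgM.
  by rewrite !involution_inv //; apply: conj_generator_involution.
have [] := P x y; rewrite nE; case: n {nE} => [//|[|//]] _ /(_ 1%N)[_ /(_ isT)].
rewrite expg1 => xy1; case: xy; rewrite -(mulg1_eq xy1) involution_inv //.
exact: conj_generator_involution.
Qed.

Local Notation Rl := (@coxeter_relators _ ST conj_exponent).

Lemma pres_eq_val_word u v : pres_eq Rl u v -> val_word u = val_word v.
Proof.
apply: pres_eq_sound => _ [x [y [n [xyn ->]]]].
rewrite (coxeter_val_relator x y) //.
apply/(order_exponentP (val x * val y)).2.
by rewrite -/(conj_exponent _ _) xyn /= dvdnn.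
Qed.

Lemma pres_eq_power (x y : ST) n u :
  exponent_dvd (conj_exponent (val x) (val y)) n ->
  pres_eq Rl (flatten (nseq n [:: (x, true); (y, true)]) ++ u) u.
Proof.
case xy: (conj_exponent _ _) => [k|] /=; last by move=> /eqP->; apply: pres_eq_refl.
move=> /dvdnP[q ->]; elim: q => [|q IHq]; first exact: pres_eq_refl.
rewrite mulSn nseqD flatten_cat -catA.
apply: (pres_eq_trans _ IHq); apply: (@pres_eq_rel _ Rl [::] _ (_ ++ u)).
by exists x, y, k.
Qed.

Lemma pres_eq_square (x : ST) u : pres_eq Rl ((x, true) :: (x, true) :: u) u.
Proof.
by apply: (@pres_eq_power x x 1%N u); rewrite conj_exponent_matrix.1.
Qed.

Lemma pres_eq_flip (x : ST) b u : pres_eq Rl ((x, b) :: u) ((x, true) :: u).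
Proof.
case: b; first exact: pres_eq_refl.
apply: (@pres_eq_trans _ _ _ ((x, false) :: (x, true) :: (x, true) :: u)).
  by apply/pres_eq_sym/pres_eq_cons/pres_eq_square.
exact: (pres_eq_cancel Rl [::] ((x, true) :: u) x false).
Qed.

(* The default value x is only taken when g is not in W_(S - T). *)
Definition conj_letter g (x : ST) : ST := insubd x (g * val x * g^-1).

Lemma val_conj_letter g x : WR g -> val (conj_letter g x) = g * val x * g^-1.
Proof.
by move=> Rg; rewrite insubdK // inE; apply/conj_generator_conj.
Qed.

Definition conj_word g (u : gword ST) : gword ST :=
  [seq (conj_letter g p.1, p.2) | p <- u].

Lemma conj_word_cat g u v : conj_word g (u ++ v) = conj_word g u ++ conj_word g v.
Proof. exact: map_cat. Qed.

Lemma conj_word1 u : conj_word 1 u = u.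
Proof.
rewrite -[RHS]map_id; apply: eq_map => -[x b] /=; congr (_, _); apply: val_inj.
by rewrite val_conj_letter ?mul1g ?invg1 ?mulg1 //; exact: (generated_subgroup _).1.
Qed.

Lemma conj_wordM g h u : WR g -> WR h ->
  conj_word (g * h) u = conj_word g (conj_word h u).
Proof.
move=> Rg Rh; rewrite /conj_word -map_comp; apply: eq_map => -[x b] /=.
congr (_, _); apply: val_inj; rewrite !val_conj_letter //.
  by rewrite invgM !mulgA.
exact: (subgroupM (generated_subgroup _)).
Qed.

Lemma conj_wordK g u : WR g -> conj_word g (conj_word g^-1 u) = u.
Proof.
move=> Rg; rewrite -conj_wordM ?mulgV ?conj_word1 //.
exact: (subgroupV (generated_subgroup _)).
Qed.

Lemma conj_word_pres g u v : WR g -> pres_eq Rl u v ->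
  pres_eq Rl (conj_word g u) (conj_word g v).
Proof.
move=> Rg; elim=> {u v} [u|u v _ IH|u v w _ IH1 _ IH2|u v x c|u r v].
- exact: pres_eq_refl.
- exact: pres_eq_sym.
- exact: pres_eq_trans IH1 IH2.
- by rewrite !conj_word_cat; apply: pres_eq_cancel.
move=> [x [y [n [xyn ->]]]]; rewrite !conj_word_cat; apply: pres_eq_rel.
exists (conj_letter g x), (conj_letter g y), n; split.
  rewrite -xyn; apply: is_order_uniq (order_exponentP _) _.
  apply: eq_is_order (order_exponentP _) => k.
  rewrite !val_conj_letter //.
  have -> : g * val x * g^-1 * (g * val y * g^-1) = g * (val x * val y) * g^-1.
    by rewrite !mulgA mulgVK.
  exact: expg_conj_eq1.
by rewrite /conj_word map_flatten map_nseq.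
Qed.

Definition word_class (u : gword ST) : set (gword ST) := [set v | pres_eq Rl u v].

Lemma word_class_eq u v : word_class u = word_class v <-> pres_eq Rl u v.
Proof.
split=> [uv|uv].
  by have : word_class u v by rewrite uv; apply: pres_eq_refl.
apply/seteqP; split=> w; first exact/pres_eq_trans/pres_eq_sym.
exact: pres_eq_trans.
Qed.

Definition conj_act g (A : set (gword ST)) : set (gword ST) :=
  [set v | A (conj_word g^-1 v)].

Lemma conj_act_class g u : WR g ->
  conj_act g (word_class u) = word_class (conj_word g u).
Proof.
move=> Rg; have Rg' := subgroupV (generated_subgroup _) Rg.
apply/seteqP; split=> v /= h.
  by have := conj_word_pres Rg h; rewrite conj_wordK.
have := conj_word_pres Rg' h.
by rewrite -{2}[g]invgK conj_wordK.
Qed.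

(** An action of W on the group presented by the generators S_T and the relators
    of their pairwise orders: T acts by left multiplication, S - T by
    conjugation. It is the action of the semidirect product of that group with
    W_(S - T) on the cosets of the second factor. *)
Definition generator_act s (A : set (gword ST)) : set (gword ST) :=
  if pselect (T s) is left Ts then
    [set v | A ((SigSub (mem_set (sub_conj_generators Ts)), true) :: v)]
  else conj_act s A.

Lemma generator_act_class (x : ST) u : T (val x) ->
  generator_act (val x) (word_class u) = word_class ((x, true) :: u).
Proof.
rewrite /generator_act; case: pselect => // Tx _.
have -> : SigSub (mem_set (sub_conj_generators Tx)) = x by apply: val_inj.
apply/seteqP; split=> v /= h.
  apply: pres_eq_trans (pres_eq_square x v); exact: pres_eq_cons.
exact: pres_eq_trans (pres_eq_sym (pres_eq_square x u)) (pres_eq_cons _ h).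
Qed.

Lemma generator_act_conj s A : ~ T s -> generator_act s A = conj_act s A.
Proof. by rewrite /generator_act; case: pselect. Qed.

Local Notation classes := (range word_class).

Lemma conj_act_action : is_action classes WR conj_act.
Proof.
split=> [g _ Rg [u _ <-]|_ [u _ <-]|g h _ Rg Rh [u _ <-]].
- by rewrite conj_act_class //; exists (conj_word g u).
- rewrite conj_act_class ?conj_word1 //; exact: (generated_subgroup _).1.
rewrite !conj_act_class //; last exact: (subgroupM (generated_subgroup _)).
by rewrite conj_wordM.
Qed.

Lemma generator_act_stable s A : S s -> classes A -> classes (generator_act s A).
Proof.
move=> Ss [u _ <-]; have [Ts|nTs] := pselect (T s).
  have sST : ST s by exact: sub_conj_generators.
  rewrite (@generator_act_class (SigSub (mem_set sST)) u Ts).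
  by exists ((SigSub (mem_set sST), true) :: u).
rewrite generator_act_conj // conj_act_class; last exact: sub_generated.
by exists (conj_word s u).
Qed.

Lemma generator_act_relation s t n A : S s -> S t -> m s t = Some n ->
  classes A -> iter n (fun A => generator_act s (generator_act t A)) A = A.
Proof.
have RS := generated_subgroup (S `\` T).
have TR t' s' k B : T t' -> (S `\` T) s' -> m t' s' = Some k -> classes B ->
    iter k (fun A => generator_act t' (generator_act s' A)) B = B.
  move=> Tt [Ss nTs] mts [u _ <-].
  have Rs : WR s' by apply: sub_generated.
  have ss1 := coxeter_involution hW Ss.
  have tST : ST t' by exact: sub_conj_generators.
  pose x : ST := SigSub (mem_set tST).
  pose f A := generator_act t' (generator_act s' A).
  (* The square of the action of t s is left multiplication by t (s t s), so half
     as many factors are needed; this is where the exponent has to be even. *)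
  have ff v : f (f (word_class v)) =
      word_class ([:: (x, true); (conj_letter s' x, true)] ++ v).
    rewrite /f !(generator_act_conj _ nTs) conj_act_class //.
    rewrite (@generator_act_class x) // conj_act_class //.
    rewrite (@generator_act_class x) //= -conj_wordM //.
    by rewrite ss1 conj_word1.
  have := hT Tt (conj Ss nTs); rewrite mts /= => /even_halfK kE.
  rewrite -kE -muln2 iterM.
  have -> : forall j, iter j (iter 2 f) (word_class u) =
      word_class (flatten (nseq j [:: (x, true); (conj_letter s' x, true)]) ++ u).
    by elim=> // j IHj; rewrite iterS IHj /= ff.
  apply/word_class_eq/pres_eq_power/(order_exponentP _).2.
  rewrite val_conj_letter // (involution_inv ss1) -[val x]/t'.
  have -> : t' * (s' * t' * s') = (t' * s') ^+ 2 by rewrite expg2 !mulgA.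
  rewrite -expgnA mul2n kE; apply: (coxeter_relation hW) => //; exact: hTS.
move=> Ss St mst AD.
have [Ts|nTs] := pselect (T s); have [Tt|nTt] := pselect (T t).
- have [u _ <-] := AD.
  have sST : ST s by exact: sub_conj_generators.
  have tST : ST t by exact: sub_conj_generators.
  pose x : ST := SigSub (mem_set sST); pose y : ST := SigSub (mem_set tST).
  transitivity (word_class (flatten (nseq n [:: (x, true); (y, true)]) ++ u)).
    elim: (n) => // k IHk; rewrite iterS IHk.
    by rewrite (@generator_act_class y) // (@generator_act_class x).
  apply/word_class_eq/pres_eq_power/(order_exponentP _).2.
  exact: (coxeter_relation hW Ss St mst).
- exact: TR.
- have mts : m t s = Some n by rewrite (coxeter_sym hW).
  have [B BD <-] : exists2 B, classes B & generator_act s B = A.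
    exists (generator_act s A); first exact: generator_act_stable.
    have := TR _ _ _ A Tt (conj Ss nTs) mts AD.
    rewrite !generator_act_conj //.
    have [_ a1 aM] := conj_act_action.
    rewrite -aM //; try exact: sub_generated.
    by rewrite (coxeter_involution hW Ss) a1.
  by rewrite iter_swap TR.
- have Rs : WR s by apply: sub_generated.
  have Rt : WR t by apply: sub_generated.
  have [aD a1 aM] := conj_act_action.
  transitivity (conj_act ((s * t) ^+ n) A).
    have Rst := subgroupM RS Rs Rt.
    rewrite (action_iter _ RS conj_act_action) //.
    have itD k : classes (iter k (conj_act (s * t)) A).
      by elim: k => //= k; apply: aD.
    by elim: (n) => //= k ->; rewrite !generator_act_conj // aM.
  by rewrite (coxeter_relation hW Ss St mst) a1.
Qed.

(** The matrix of the pairwise orders makes its relators true, and a word in the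
    generators S_T, evaluated in W, moves the class of the empty word to its own
    class. Words with the same value therefore have the same class, that is, no
    further relators are needed. *)
Lemma normal_closure_coxeter : coxeter_system N ST conj_exponent.
Proof.
split; first exact: conj_exponent_matrix.
split; first exact: range_conj_generators.
move=> u v; split; last exact: pres_eq_val_word.
have RS := generated_subgroup (S `\` T).
have [|s t n A Ss St mst|rho [rA rS]] := coxeter_action hW
    (D := classes) (sigma := generator_act).
- exact: generator_act_stable.
- exact: generator_act_relation.
have rR g A : WR g -> classes A -> rho g A = conj_act g A.
  apply: (action_agree _ _ rA conj_act_action) => // s A' [Ss nTs] AD.
  by rewrite rS // generator_act_conj.
have [rD r1 rM] := rA.
have rST (x : ST) w : rho (val x) (word_class w) = word_class ((x, true) :: w).
  have [t Tt [g Rg xE]] := valST x; have Rg' := subgroupV RS Rg.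
  have tST : ST t by exact: sub_conj_generators.
  pose y : ST := SigSub (mem_set tST).
  have cD w' : classes (word_class w') by exists w'.
  rewrite -xE -mulgA !rM //; try exact: rD.
  rewrite (rR g^-1) // conj_act_class // (rS t) //; last exact: hTS.
  rewrite (@generator_act_class y) // rR // conj_act_class //= conj_wordK //.
  congr (word_class ((_, _) :: _)); apply: val_inj.
  by rewrite val_conj_letter.
have rW w : rho (val_word w) (word_class [::]) = word_class w.
  elim: w => [|[x b] w IHw]; first by rewrite gword_val_nil r1 //; exists [::].
  have cD w' : classes (word_class w') by exists w'.
  rewrite gword_val_cons /= involution_inv; last first.
    exact/conj_generator_involution/valST.
  rewrite if_same rM // IHw rST; apply/word_class_eq/pres_eq_sym/pres_eq_flip.
by move=> uv; apply/word_class_eq; rewrite -[LHS]rW -[RHS]rW uv.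
Qed.

End NormalClosure.

(** * A representation of W on functions of cosets *)

Section CosetRepresentation.
Variables (W : groupType) (S T : set W) (m : W -> W -> exponent).
Hypothesis hW : coxeter_system [set: W] S m.
Hypothesis hTS : T `<=` S.
Hypothesis hT : forall t s, T t -> (S `\` T) s -> even_or_infty (m t s).

Local Notation WR := (generated (S `\` T)).
Local Notation perpT t := (generated (perp S m t `\` T)).

Let X := (W * set W)%type.

Lemma perpT_WR t g : perpT t g -> WR g.
Proof. by apply: generatedS => s [[]]. Qed.

Lemma perpT_commute t g : T t -> perpT t g -> commute g t.
Proof.
move=> Tt; apply: generated_commute => s [[Ss mst] _].
have St := hTS Tt; have st2 := coxeter_relation hW Ss St mst.
move: st2; rewrite expg2 => /mulg1_eq; rewrite invgM.
by rewrite !involution_inv //; apply: (coxeter_involution hW).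
Qed.

(** The pair of t and the coset w W_(t^perp - T) stands for the element w t w^-1
    of S_T; whether distinct cosets give distinct elements is not known
    beforehand, which is why the coset is kept instead of the element. *)
Definition base_coset t : X := (t, perpT t).

Definition translate g (x : X) : X := (x.1, [set y | x.2 (g^-1 * y)]).

Definition links (x y : X) : set W :=
  [set s | (S `\` T) s /\ exists2 a, x.2 a & y.2 (a * s)].

(** The exponent that the theorem predicts for the elements of S_T which x and y
    stand for, if x and y are distinct. With x = (t1, w1 A) and y = (t2, w2 B), the cosets meet when
    w1^-1 w2 is in the product A B, and s is in links x y when it lies in
    A w1^-1 w2 B. This formulation is visibly invariant under left
    translation. *)
Definition coset_exponent (x y : X) : exponent :=
  if x.1 == y.1 then
    if `[< links x y !=set0 >] then exponent_half (m (xget 1 (links x y)) x.1)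
    else None
  else if `[< x.2 `&` y.2 !=set0 >] then m x.1 y.1 else None.

Definition coset_form (x y : X) : algC :=
  (if `[< x = y >] then 2%:R else cartan_entry (coset_exponent x y))%R.

Lemma coset_form_diag x : coset_form x x = 2%:R%R.
Proof. by rewrite /coset_form; case: asboolP. Qed.

Lemma coset_form_neq x y : x <> y ->
  coset_form x y = cartan_entry (coset_exponent x y).
Proof. by rewrite /coset_form; case: asboolP. Qed.

Lemma links_sym x y : links x y = links y x.
Proof.
apply/seteqP; split=> s [[Ss nTs] [a xa ya]]; split=> //; exists (a * s) => //;
  by rewrite -mulgA (coxeter_involution hW Ss) mulg1.
Qed.

Lemma coset_form_sym x y : S x.1 -> S y.1 -> coset_form x y = coset_form y x.
Proof.
move=> Sx Sy; rewrite /coset_form (asbool_equiv_eq (Q := y = x)); last by split.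
case: asboolP => // _; congr cartan_entry.
rewrite /coset_exponent eq_sym links_sym setIC (coxeter_sym hW Sx Sy).
by case: eqP => // ->.
Qed.

Lemma translateM g h x : translate (g * h) x = translate g (translate h x).
Proof. by congr (_, _); apply/funext => y /=; rewrite invgM mulgA. Qed.

Lemma translate1 x : translate 1 x = x.
Proof.
by case: x => t C; congr (_, _); apply/funext => y /=; rewrite invg1 mul1g.
Qed.

Lemma translateK g : cancel (translate g) (translate g^-1).
Proof. by move=> x; rewrite -translateM mulVg translate1. Qed.

Lemma links_translate g x y : links (translate g x) (translate g y) = links x y.
Proof.
apply/seteqP; split=> s [Rs [a xa ya]]; split=> //.
  by exists (g^-1 * a); rewrite // -mulgA.
by exists (g * a) => /=; rewrite -?mulgA mulKg.
Qed.

Lemma meet_translate g x y :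
  ((translate g x).2 `&` (translate g y).2 !=set0) = (x.2 `&` y.2 !=set0).
Proof.
apply/propext; split=> -[a [xa ya]]; first by exists (g^-1 * a).
by exists (g * a); split; rewrite /= mulKg.
Qed.

Lemma coset_form_translate g x y :
  coset_form (translate g x) (translate g y) = coset_form x y.
Proof.
rewrite /coset_form /coset_exponent links_translate meet_translate.
rewrite (asbool_equiv_eq (Q := x = y)) //; split=> [|-> //].
exact/can_inj/translateK.
Qed.

Definition translation_act g (f : X -> algC) : X -> algC :=
  fun x => f (translate g^-1 x).

Lemma translation_action G : is_action [set: X -> algC] G translation_act.
Proof.
split=> // [f _|g h f _ _ _]; apply/funext => x; rewrite /translation_act.
  by rewrite invg1 translate1.
by rewrite invgM translateM.
Qed.

Lemma translation_reflection g x f :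
  translation_act g (reflection coset_form x (translation_act g^-1 f)) =
  reflection coset_form (translate g x) f.
Proof.
apply/funext => y; rewrite /translation_act /reflection invgK.
rewrite -(coset_form_translate g x).
by rewrite -!translateM mulgV translate1.
Qed.

(** T acts by the reflections of the Coxeter group that the theorem predicts, and
    S - T by the symmetries of its matrix. *)
Definition coset_act s (f : X -> algC) : X -> algC :=
  if `[< T s >] then reflection coset_form (base_coset s) f
  else translation_act s f.

Lemma coset_actT t f : T t ->
  coset_act t f = reflection coset_form (base_coset t) f.
Proof. by rewrite /coset_act; case: asboolP. Qed.

Lemma coset_actR s f : ~ T s -> coset_act s f = translation_act s f.
Proof. by rewrite /coset_act; case: asboolP. Qed.

(** Another link s' would lie in the double coset of s, hence in the subgroup
    generated by s and t^perp - T, and would therefore be one of these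
    generators; but a link in t^perp - T would force s into W_(t^perp - T).
    Hence the exponent predicted for t and s t s^-1 is unambiguous. *)
Lemma links_base t s : T t -> (S `\` T) s -> ~ perpT t s ->
  links (base_coset t) (translate s (base_coset t)) = [set s].
Proof.
move=> Tt [Ss nTs] ns; have PS := generated_subgroup (perp S m t `\` T).
apply/seteqP; split=> [s' [[Ss' nTs'] [a /= ta tas]]|_ ->]; last first.
  split=> //; exists 1; first exact: PS.1.
  by rewrite mul1g /= mulVg; exact: PS.1.
pose U := [set u | (perp S m t `\` T) u \/ u = s].
have US := generated_subgroup U.
have tU g : perpT t g -> generated U g by apply: generatedS => u; left.
have Us' : generated U s'.
  have -> : s' = a^-1 * (s * (s^-1 * (a * s'))) by rewrite mulVKg mulKg.
  apply: (subgroupM US); first exact: (subgroupV US (tU _ ta)).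
  by apply: (subgroupM US); [apply: sub_generated; right | exact: (tU _ tas)].
have [|//] : U s'.
  by apply: (generated_generator hW) Us' => // u [[[]]|->].
move=> /sub_generated ps'; case: ns.
have -> : s = a * s' * (s^-1 * (a * s'))^-1.
  by rewrite invgM invgK mulgA mulgV mul1g.
apply: (subgroupM PS); last exact: (subgroupV PS).
exact: (subgroupM PS).
Qed.

Lemma coset_reflection_order x y n : S x.1 -> S y.1 -> x <> y ->
  proper_exponent (coset_exponent x y) ->
  (forall f, iter n (fun f => reflection coset_form x
                              (reflection coset_form y f)) f = f) <->
  exponent_dvd (coset_exponent x y) n.
Proof.
move=> Sx Sy xy exy; apply: reflection_order => //.
- exact: coset_form_diag.
- exact: coset_form_diag.
- exact: coset_form_neq.
- by rewrite coset_form_sym //; apply: coset_form_neq.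
Qed.

(** The square of the product of t and s is the product of the reflections in
    the coset of t and in its translate by s, and the predicted exponent of this
    pair is half of m t s. *)
Lemma coset_act_relation_even t s n f : T t -> (S `\` T) s -> m t s = Some n ->
  iter n (fun f => coset_act t (coset_act s f)) f = f.
Proof.
move=> Tt Rs mts; have [Ss nTs] := Rs; have St := hTS Tt.
pose x := base_coset t; pose y := translate s x.
have ss := involution_inv (coxeter_involution hW Ss).
have := hT Tt Rs; rewrite mts /= => /even_halfK nE; rewrite -nE -muln2 iterM.
transitivity (iter n./2 (fun f => reflection coset_form x
                                  (reflection coset_form y f)) f).
  apply: eq_iter => g /=; rewrite !(coset_actT _ Tt) !(coset_actR _ nTs).
  congr (reflection _ _ _).
  by rewrite -(translation_reflection s) ss.
have [xy|nxy] := pselect (x = y).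
  elim: (n./2) => //= k ->; rewrite -xy; exact/reflectionK/coset_form_diag.
have ns : ~ perpT t s.
  move=> ps; apply: nxy; have PS := generated_subgroup (perp S m t `\` T).
  congr (_, _); apply/seteqP; split=> g /= pg.
    by apply: (subgroupM PS) => //; apply: (subgroupV PS).
  by rewrite -[g](mulVKg s); apply: (subgroupM PS).
have st : s <> t by move=> st; apply: nTs; rewrite st.
have exyE : coset_exponent x y = exponent_half (m t s).
  rewrite /coset_exponent eqxx links_base //.
  rewrite (coxeter_sym hW St Ss).
  have -> : xget 1 [set s] = s by apply: xget_unique.
  by case: asboolP => // -[]; exists s.
have exyP : proper_exponent (coset_exponent x y).
  rewrite exyE mts /=.
  have := coxeter_proper hW St Ss (nesym st); rewrite mts /= => n1.
  rewrite ltnNge; apply/negP => n2; apply: ns; apply: sub_generated.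
  split=> //; split=> //; rewrite -(coxeter_sym hW St Ss) mts -nE.
  have : (0 < n./2)%N by rewrite half_gt0.
  by case: (n./2) n2 => [|[]].
have [_ ->//] := @coset_reflection_order x y n./2 St St nxy exyP.
by rewrite exyE mts /=.
Qed.

Lemma coset_act_relation s t n f : S s -> S t -> m s t = Some n ->
  iter n (fun f => coset_act s (coset_act t f)) f = f.
Proof.
move=> Ss St mst.
have [Ts|nTs] := pselect (T s); have [Tt|nTt] := pselect (T t).
- transitivity (iter n (fun f => reflection coset_form (base_coset s)
      (reflection coset_form (base_coset t) f)) f).
    by apply: eq_iter => g; rewrite !coset_actT.
  have [ste|/eqP st] := eqVneq s t.
    move: mst; rewrite -ste (coxeter_diag hW) // => -[<-] /=.
    exact/reflectionK/coset_form_diag.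
  have exyE : coset_exponent (base_coset s) (base_coset t) = m s t.
    rewrite /coset_exponent /=; case: eqP => // _; case: asboolP => // -[].
    by exists 1; split; apply: (generated_subgroup _).1.
  have nxy : base_coset s <> base_coset t by move=> [].
  have [|_ ->//] := @coset_reflection_order (base_coset s) (base_coset t) n Ss St nxy.
    by rewrite exyE; exact: (coxeter_proper hW Ss St st).
  by rewrite exyE mst /=.
- exact: coset_act_relation_even.
- have mts : m t s = Some n by rewrite (coxeter_sym hW).
  have <- : coset_act s (coset_act s f) = f.
    have [_ a1 aM] := translation_action [set: W].
    rewrite !(coset_actR _ nTs) -aM // (coxeter_involution hW Ss).
    exact: a1.
  by rewrite iter_swap coset_act_relation_even.
- have [_ a1 aM] := translation_action [set: W].
  have WS : is_subgroup [set: W] by [].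
  transitivity (translation_act ((s * t) ^+ n) f).
    rewrite (action_iter _ WS (translation_action _)) //.
    by apply: eq_iter => g; rewrite !coset_actR // aM.
  by rewrite (coxeter_relation hW Ss St mst); apply: a1.
Qed.

Lemma coset_representation : exists rho : W -> (X -> algC) -> (X -> algC),
  is_action [set: X -> algC] [set: W] rho /\
  forall t w f, T t -> WR w ->
    rho (w * t * w^-1) f = reflection coset_form (translate w (base_coset t)) f.
Proof.
have [//|s t n f Ss St mst _|rho [rA rS]] := coxeter_action hW
    (D := [set: X -> algC]) (sigma := coset_act).
  exact: coset_act_relation.
exists rho; split=> // t w f Tt Rw; have [_ r1 rM] := rA.
have rR g f' : WR g -> rho g f' = translation_act g f'.
  move=> Rg; apply: (action_agree _ _ rA (translation_action _)) Rg _ => //.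
  by move=> s f'' [Ss nTs] _; rewrite rS // coset_actR.
rewrite !rM // (rR w^-1); last exact: (subgroupV (generated_subgroup _)).
rewrite rR // rS //; last exact: hTS.
by rewrite coset_actT // translation_reflection.
Qed.

(** Reflections in distinct indices differ: the indicator of the first index is
    negated by the one and fixed by the other. *)
Lemma conj_eq_coset t1 t2 w1 w2 : T t1 -> T t2 -> WR w1 -> WR w2 ->
  w1 * t1 * w1^-1 = w2 * t2 * w2^-1 ->
  translate w1 (base_coset t1) = translate w2 (base_coset t2).
Proof.
move=> T1 T2 R1 R2 E; apply: contrapT => nx.
set x := translate w1 _ in nx; set y := translate w2 _ in nx.
have [rho [_ rP]] := coset_representation.
have := rP t1 w1 (indicator algC x) T1 R1; rewrite E rP // => /(congr1 (@^~ x)).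
rewrite reflection_indicator ?coset_form_diag // reflection_fix; last first.
  exact: (indicator_neq _ (nesym nx)).
rewrite indicator_id; exact: one_neq_opp1.
Qed.

(** The product acts as the product of two reflections whose predicted exponent
    is infinite, and no positive power of that is the identity. *)
Lemma conj_product_infinite t1 t2 w1 w2 n : T t1 -> T t2 -> WR w1 -> WR w2 ->
  let x := translate w1 (base_coset t1) in
  let y := translate w2 (base_coset t2) in
  x <> y -> coset_exponent x y = None ->
  (w1 * t1 * w1^-1 * (w2 * t2 * w2^-1)) ^+ n = 1 -> n = 0%N.
Proof.
move=> T1 T2 R1 R2 x y nxy exy.
set g := _ * _ => gn; have [rho [rA rP]] := coset_representation.
have [_ r1 rM] := rA.
have WS : is_subgroup [set: W] by [].
apply/eqP; rewrite -/(exponent_dvd None n) -exy.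
apply/(@coset_reflection_order x y n (hTS T1) (hTS T2) nxy).
  by rewrite exy.
move=> f; transitivity (rho (g ^+ n) f); last by rewrite gn r1.
rewrite (action_iter _ WS rA) //; apply: eq_iter => f'.
by rewrite rM // !rP.
Qed.

End CosetRepresentation.

(** * Shortest elements of double cosets *)

Section ShortestElements.
Variables (W : groupType) (S : set W) (m : W -> W -> exponent).
Hypothesis hW : coxeter_system [set: W] S m.

Local Notation val_word := (gword_val (fun s : S => val s)).

Lemma word_length_spec w : (exists2 u, val_word u = w & size u = word_length S w) /\
  forall u, val_word u = w -> (word_length S w <= size u)%N.
Proof.
have [u0 _ u0w] : range val_word w by rewrite hW.2.1.
have exl : exists n, `[< exists2 u, val_word u = w & size u = n >].
  by exists (size u0); apply/asboolP; exists u0.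
pose L := [set size u | u in [set u : gword S | val_word u = w]].
have := @xgetPex _ 0%N [set n | L n /\ forall k, L k -> (n <= k)%N].
rewrite -/(word_length S w) => -[|[u uw <-] minL].
  case: (ex_minnP exl) => n /asboolP[u uw un] nmin.
  exists n; split; first by exists u.
  by move=> _ [v vw <-]; apply: nmin; apply/asboolP; exists v.
by split=> [|v vw]; [exists u | apply: minL; exists v].
Qed.

Lemma word_length1 : word_length S 1 = 0%N.
Proof.
apply/eqP; rewrite -leqn0.
by have [_ /(_ [::])] := word_length_spec 1; apply; apply: gword_val_nil.
Qed.

Lemma word_length_eq0 w : word_length S w = 0%N -> w = 1.
Proof.
have [[u uw <-] _] := word_length_spec w; move/size0nil => u0.
by rewrite -uw u0 gword_val_nil.
Qed.

Lemma word_length_le1 w : (word_length S w <= 1)%N -> w = 1 \/ S w.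
Proof.
have [[u uw <-] _] := word_length_spec w.
case: u uw => [|[s b] [|//]] uw _; first by left; rewrite -uw gword_val_nil.
have Ss : S (val s) by have := valP s; rewrite inE.
right; rewrite -uw gword_val_cons gword_val_nil mulg1 /=.
by rewrite (involution_inv (coxeter_involution hW Ss)) if_same.
Qed.

Lemma word_length_generator s : S s -> (word_length S s <= 1)%N.
Proof.
move=> Ss; have [_ /(_ [:: (SigSub (mem_set Ss), true)])] := word_length_spec s.
by apply; rewrite gword_val_cons gword_val_nil mulg1.
Qed.

Section DoubleCoset.
Variables (A B : set W) (w : W).
Local Notation D := (double_coset (generated A) (generated B) w).
Local Notation v := (shortest_dcoset S A B w).

Lemma shortest_dcosetP :
  D v /\ forall y, D y -> (word_length S v <= word_length S y)%N.
Proof.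
apply: (@xgetPex _ 1 [set x | D x /\
  forall y, D y -> (word_length S x <= word_length S y)%N]).
have Dw : D w.
  exists 1; first exact: (generated_subgroup _).1.
  exists 1; first exact: (generated_subgroup _).1.
  by rewrite mul1g mulg1.
have exl : exists n, `[< exists2 x, D x & word_length S x = n >].
  by exists (word_length S w); apply/asboolP; exists w.
case: (ex_minnP exl) => n /asboolP[x Dx xn] nmin; exists x; split=> // y Dy.
by rewrite xn; apply: nmin; apply/asboolP; exists y.
Qed.

Lemma shortest_dcoset_eq1 : v = 1 <-> D 1.
Proof.
have [Dv vmin] := shortest_dcosetP; split=> [<- //|/vmin].
by rewrite word_length1 leqn0 => /eqP/word_length_eq0.
Qed.

Lemma shortest_dcoset_generator s : S s -> D s -> v = 1 \/ S v.
Proof.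
move=> Ss /shortest_dcosetP.2 vs; apply: word_length_le1.
exact: leq_trans vs (word_length_generator Ss).
Qed.

End DoubleCoset.
End ShortestElements.

Theorem corollary3p1 (W : groupType) (S T : set W) (m : W -> W -> exponent)
  (hW : coxeter_system [set: W] S m)
  (hTS : T `<=` S)
  (hT : forall t s, T t -> (S `\` T) s -> even_or_infty (m t s)) :
  let N := normal_closure (generated T) in
  let ST := conj_generators S T in
  (exists M : W -> W -> exponent, coxeter_system N ST M) /\
  forall t1 t2 w1 w2 : W,
    T t1 -> T t2 ->
    generated (S `\` T) w1 -> generated (S `\` T) w2 ->
    let tau1 := w1 * t1 * w1^-1 in
    let tau2 := w2 * t2 * w2^-1 in
    let star := shortest_dcoset S (perp S m t1 `\` T) (perp S m t2 `\` T) in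
    let v := star (w1^-1 * w2) in
    (tau1 = tau2 <-> t1 = t2 /\ v = 1) /\
    (tau1 <> tau2 ->
     forall M : W -> W -> exponent, coxeter_system N ST M ->
       [/\ t1 <> t2 /\ v = 1 -> M tau1 tau2 = m t1 t2,
           t1 = t2 /\ (S `\` T) v -> M tau1 tau2 = exponent_half (m v t1) &
           ~ (t1 <> t2 /\ v = 1) /\ ~ (t1 = t2 /\ (S `\` T) v) ->
             M tau1 tau2 = None]).
Proof.
move=> N ST; split.
  by exists (@conj_exponent W); apply: normal_closure_coxeter hW _ _.
move=> t1 t2 w1 w2 T1 T2 R1 R2 tau1 tau2 star v.
have RS := generated_subgroup (S `\` T).
set A1 := perp S m t1 `\` T in star v *; set A2 := perp S m t2 `\` T in star v *.
have AS1 := generated_subgroup A1; have AS2 := generated_subgroup A2.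
have [h Ah [k Ak vE]] :
    double_coset (generated A1) (generated A2) (w1^-1 * w2) v.
  exact: (shortest_dcosetP S A1 A2 (w1^-1 * w2)).1.
have ht : commute h t1 by apply: (perpT_commute hW hTS T1).
have kt : commute k t2 by apply: (perpT_commute hW hTS T2).
(* Both generators are conjugated by the same g to t1 and v t2 v^-1. *)
pose g := w1 * h^-1.
have tau1E : tau1 = g * t1 * g^-1.
  rewrite /tau1 /g invgM invgK -!mulgA; congr (_ * _).
  by rewrite (mulgA t1 h) -ht !mulgA mulVg mul1g.
have tau2E : tau2 = g * (v * t2 * v^-1) * g^-1.
  rewrite /tau2.
  have -> : w2 = g * v * k^-1 by rewrite /g -vE !mulgA mulgVK mulgV mul1g mulgK.
  rewrite !invgM !invgK -!mulgA; congr (_ * (_ * _)).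
  by rewrite (mulgA t2 k) -kt !mulgA mulgVK.
clearbody g.
(* Incidences of the cosets of w1 and w2 are memberships in the double coset. *)
have in_dcoset x y z : generated A1 (w1^-1 * x) -> generated A2 (w2^-1 * y) ->
    y = x * z -> double_coset (generated A1) (generated A2) (w1^-1 * w2) z.
  move=> xA yA yz; exists (w1^-1 * x)^-1; first exact: (subgroupV AS1 xA).
  exists (w2^-1 * y) => //.
  by rewrite yz invgM invgK -!mulgA mulVKg mulVKg mulKg.
split.
  split=> [E|[t12 v1]]; last by rewrite tau1E tau2E v1 t12 invg1 mulg1 mul1g.
  have [t12 CE] := conj_eq_coset hW hTS hT T1 T2 R1 R2 E.
  split=> //; apply/(shortest_dcoset_eq1 hW).
  apply: (@in_dcoset w2 w2); rewrite ?mulg1 ?mulVg //; last exact: AS2.1.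
  have : [set y | generated A2 (w2^-1 * y)] w2 by rewrite /= mulVg; exact: AS2.1.
  by rewrite -CE.
move=> tau12 M hM.
have tauST : ST tau1 /\ ST tau2.
  by split; [exists t1 => //; exists w1 | exists t2 => //; exists w2].
have Morder := coxeter_order hM tauST.1 tauST.2.
have ME e : is_order (t1 * (v * t2 * v^-1)) e -> M tau1 tau2 = e.
  move=> vP; apply: is_order_uniq Morder (eq_is_order _ vP) => n.
  by rewrite -(expg_conj_eq1 g (t1 * _)) tau1E tau2E !mulgA mulgVK.
split.
- move=> [_ v1]; apply: ME; rewrite v1 mul1g invg1 mulg1.
  by apply: (coxeter_order hW); apply: hTS.
- move=> [t12 [Sv nTv]]; apply: ME; rewrite -t12.
  rewrite (involution_inv (coxeter_involution hW Sv)).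
  rewrite (mulgA t1) (mulgA t1) -(mulgA (t1 * v)).
  rewrite -expg2 (coxeter_sym hW Sv (hTS t1 T1)).
  apply: is_order_half; first exact: hT.
  by apply: (coxeter_order hW) => //; apply: hTS.
move=> [n1 n2].
pose x := translate w1 (base_coset S T m t1).
pose y := translate w2 (base_coset S T m t2).
have nxy : x <> y.
  move=> [t12 CE]; apply: tau12.
  have : [set z | generated A2 (w2^-1 * z)] w2 by rewrite /= mulVg; exact: AS2.1.
  rewrite -CE /= => Aw.
  have := perpT_commute hW hTS T1 Aw.
  rewrite /commute => /(congr1 (fun z => w1 * z * w2^-1)).
  by rewrite /tau1 /tau2 -t12 !mulgA mulgV mul1g mulgK => ->.
apply: is_order_uniq Morder _; split=> // n; split=> [gn|/eqP->//].
apply/eqP; apply: (conj_product_infinite hW hTS hT T1 T2 R1 R2 nxy) gn.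
rewrite /coset_exponent; case: eqP => /= t12; case: asboolP => // -[].
  move=> s [[Ss nTs] [a xa ya]]; case: n2; split=> //.
  have Ds : double_coset (generated A1) (generated A2) (w1^-1 * w2) s.
    exact: in_dcoset xa ya _.
  have v1 : v <> 1.
    move=> v1; apply: tau12; rewrite tau1E tau2E v1 t12 invg1 mulg1 mul1g //.
  have [//|Sv] : v = 1 \/ S v := shortest_dcoset_generator hW Ss Ds.
  have Rv : generated (S `\` T) v.
    rewrite -vE; apply: (subgroupM RS); last exact: perpT_WR Ak.
    apply: (subgroupM RS); first exact: perpT_WR Ah.
    by apply: (subgroupM RS) => //; apply: (subgroupV RS).
  by apply: (generated_generator hW _ Sv Rv) => ? [].
move=> a [xa ya]; case: n1; split=> //; apply/(shortest_dcoset_eq1 hW).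
by apply: in_dcoset xa ya _; rewrite mulg1.
Qed.
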